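(* Consider the core array language and the rewrite system $\leadsto$ on its terms defined in the context. When considering only well-typed terms, the set of normal forms of the rewrite system (terms in which no rewrite rule applies to any subterm) consists precisely of those terms $t$ that satisfy the following two properties: (1) $\mathsf{build1}$ does not occur in $t$. (2) Every occurrence of a subterm $\mathsf{index}\ u\ ix'$ in $t$ has one of the following forms: $\mathsf{index}\ x\ (v ::: ix)$ with $x$ a variable reference; $\mathsf{index}\ c\ (v ::: ix)$ with $c$ a constant; $\mathsf{index}\ [\ldots]\ [v]$ (the indexed term is an array combination $[t_1,\ldots,t_n]$ and the index has length exactly one); or $\mathsf{index}\ (\mathsf{scatter}\ \_\ \_\ \_)\ (v ::: ix)$. Here $v$ is an arbitrary term and $ix$ an arbitrary (possibly empty) index.
   Context: **Syntax.** Terms $s,t,u,v$ are generated by: - $c$ (constant literal tensors); $x$ (variables); $\mathsf{let}\ x=u\ \mathsf{in}\ v$; $\mathsf{cond}\ t\ u\ v$; - $op\ u\ v$ and $op\ t$ (elementwise binary and unary arithmetic/comparison operators); - $\mathsf{index}\ t\ ix$; $\mathsf{sumOuter}\ t$; $\mathsf{gather}\ sh\ t\ (\lambda is.\ ix)$; $\mathsf{scatter}\ sh\ t\ (\lambda is.\ ix)$; - $[t_1,\ldots,t_n]$ (combining equal-shaped arrays into one array with one more dimension; a syntactic form distinct from constants); - $\mathsf{replicate}\ k\ t$; $\mathsf{tr}_{k_1,\ldots,k_n}\ t$ (generalised transposition); $\mathsf{reshape}\ sh\ t$; $\mathsf{build1}\ k\ (\lambda i.\ t)$. Here $k$ is a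 static natural number; a shape $sh$ is a list of naturals; an index $ix$ is a list of terms; $is$ is a list of variables. Lists are written $[a_1,\ldots,a_n]=a_1:::\cdots:::a_n:::[\,]$. $\lambda$ and $\mathsf{let}$ bind variables, and terms are taken up to renaming of bound variables. $FV(t)$ is the set of free variables of $t$. **Types.** Element types are $\rho ::= \mathbb R\mid \mathrm{Int}\mid\mathrm{Bool}$ ($\mathbb R$ and $\mathrm{Int}$ are called numeric). Types are $\mathrm{Array}\ sh\ \rho$. Say that $[t_1,\ldots,t_n]$ is an $n$-dim. index in $\Gamma$ if $\Gamma\vdash t_j:\mathrm{Array}\ [\,]\ \mathrm{Int}$ for all $j$. Typing rules: - A constant array of shape $sh$ with elements in $\rho$ has type $\mathrm{Array}\ sh\ \rho$; a variable has its type in $\Gamma$. - $\mathsf{let}\ x=u\ \mathsf{in}\ v:\tau$ if $\Gamma\vdash u:\sigma$ and $\Gamma,x:\sigma\vdash v:\tau$. - $\mathsf{cond}: \mathrm{Array}\ [\,]\ \mathrm{Bool}\to\mathrm{Array}\ sh\ \rho\to\mathrm{Array}\ sh\ \rho\to\mathrm{Array}\ sh\ \rho$. - Binary $op:\mathrm{Array}\ sh\ \rho\to\mathrm{Array}\ sh\ \rho\to\mathrm{Array}\ sh\ \rho$ (arithmetic) or $\to\mathrm{Array}\ sh\ \mathrm{Bool}$ (comparison); unary $op:\mathrm{Array}\ sh\ \rho\to\mathrm{Array}\ sh\ \rho$. - $\mathsf{sumOuter}:\mathrm{Array}\ (k:::sh)\ \rho\to\mathrm{Array}\ sh\ \rho$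 for numeric $\rho$. - $\mathsf{index}\ t\ ix:\mathrm{Array}\ [k_{m+1},\ldots,k_n]\ \rho$ if $t:\mathrm{Array}\ [k_1,\ldots,k_n]\ \rho$, $ix$ is an $m$-dim. index, and $m\le n$. - $\mathsf{gather}\ sh\ t\ (\lambda[i_1,\ldots,i_{m_1}].\ ix):\mathrm{Array}\ sh\ \rho$ with $sh=[k'_1,\ldots,k'_{m_1},k_{m_2+1},\ldots,k_n]$, if $t:\mathrm{Array}\ [k_1,\ldots,k_n]\ \rho$, $ix$ is an $m_2$-dim. index in $\Gamma,i_1,\ldots,i_{m_1}:\mathrm{Array}\ [\,]\ \mathrm{Int}$, and $m_1,m_2\le n$. - $\mathsf{scatter}\ sh\ t\ (\lambda[i_1,\ldots,i_{m_1}].\ ix):\mathrm{Array}\ sh\ \rho$ with $sh=[k'_1,\ldots,k'_{m_2},k_{m_1+1},\ldots,k_n]$, if $t:\mathrm{Array}\ [k_1,\ldots,k_n]\ \rho$ with $\rho$ numeric, $ix$ is an $m_2$-dim. index in $\Gamma,i_1,\ldots,i_{m_1}:\mathrm{Array}\ [\,]\ \mathrm{Int}$, and $m_1,m_2\le n$. - $[t_1,\ldots,t_n]:\mathrm{Array}\ (n:::sh)\ \rho$ if all $t_j:\mathrm{Array}\ sh\ \rho$. - $\mathsf{replicate}\ k\ t:\mathrm{Array}\ (k:::sh)\ \rho$ if $t:\mathrm{Array}\ sh\ \rho$. - $\mathsf{tr}_{j_1,\ldots,j_m}\ t:\mathrm{Array}\ [k_{j_1+1},\ldots,k_{j_m+1},k_{m+1},\ldots,k_n]\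 \rho$ if $t:\mathrm{Array}\ [k_1,\ldots,k_n]\ \rho$, $m\le n$, and $j_1,\ldots,j_m$ is a permutation of $0,\ldots,m-1$. - $\mathsf{reshape}\ sh'\ t:\mathrm{Array}\ sh'\ \rho$ if $t:\mathrm{Array}\ sh\ \rho$ and the products of the entries of $sh$ and $sh'$ agree. - $\mathsf{build1}\ k\ (\lambda i.\ t):\mathrm{Array}\ (k:::sh)\ \rho$ if $\Gamma,i:\mathrm{Array}\ [\,]\ \mathrm{Int}\vdash t:\mathrm{Array}\ sh\ \rho$. **Rewrite rules.** Rules may be applied to any subterm, including inside index lists and under binders; bound variables are renamed to avoid capture. $\mathsf{tr}$ without subscript swaps the two outermost dimensions ($\mathsf{tr}_{1,0}$). (A) Rules for $\mathsf{build1}$: - $\mathsf{build1}\ k\ (\lambda i.\ i)\leadsto[0,\ldots,k-1]$ - $\mathsf{build1}\ k\ (\lambda i.\ t)\leadsto\mathsf{replicate}\ k\ t$ if $i\notin FV(t)$ - $\mathsf{build1}\ k\ (\lambda i.\ \mathsf{let}\ x=v\ \mathsf{in}\ u)\leadsto\mathsf{let}\ x=\mathsf{build1}\ k\ (\lambda i.\ v)\ \mathsf{in}\ \mathsf{build1}\ k\ (\lambda i.\ u[\mathsf{index}\ x\ [i]/x])$ - $\mathsf{build1}\ k\ (\lambda i.\ \mathsf{cond}\ b\ u\ v)\leadsto\mathsf{build1}\ k\ (\lambda i.\ \mathsf{index}\ [u,v]\ [\mathsf{cond}\ b\ 0\ 1])$ - $\mathsf{build1}\ k\ (\lambda i.\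 op\ t\ u)\leadsto op\ (\mathsf{build1}\ k\ (\lambda i.\ t))\ (\mathsf{build1}\ k\ (\lambda i.\ u))$ - $\mathsf{build1}\ k\ (\lambda i.\ op\ t)\leadsto op\ (\mathsf{build1}\ k\ (\lambda i.\ t))$ - $\mathsf{build1}\ k\ (\lambda i.\ \mathsf{sumOuter}\ t)\leadsto\mathsf{sumOuter}\ (\mathsf{tr}\ (\mathsf{build1}\ k\ (\lambda i.\ t)))$ - $\mathsf{build1}\ k\ (\lambda i.\ \mathsf{gather}\ sh\ t\ (\lambda is.\ ix))\leadsto\mathsf{gather}\ (k:::sh)\ (\mathsf{build1}\ k\ (\lambda i.\ t))\ (\lambda(i:::is).\ i:::ix)$ - $\mathsf{build1}\ k\ (\lambda i.\ \mathsf{scatter}\ sh\ t\ (\lambda is.\ ix))\leadsto\mathsf{scatter}\ (k:::sh)\ (\mathsf{build1}\ k\ (\lambda i.\ t))\ (\lambda(i:::is).\ i:::ix)$ - $\mathsf{build1}\ k\ (\lambda i.\ [t_1,\ldots,t_n])\leadsto\mathsf{tr}\ [\mathsf{build1}\ k\ (\lambda i.\ t_1),\ldots,\mathsf{build1}\ k\ (\lambda i.\ t_n)]$ - $\mathsf{build1}\ k\ (\lambda i.\ \mathsf{replicate}\ n\ t)\leadsto\mathsf{tr}\ (\mathsf{replicate}\ n\ (\mathsf{build1}\ k\ (\lambda i.\ t)))$ - $\mathsf{build1}\ k\ (\lambda i.\ \mathsf{tr}_{b_0,\ldots,b_n}\ t)\leadsto\mathsf{tr}_{0,b_0+1,\ldots,b_n+1}\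 (\mathsf{build1}\ k\ (\lambda i.\ t))$ - $\mathsf{build1}\ k\ (\lambda i.\ \mathsf{reshape}\ sh\ t)\leadsto\mathsf{reshape}\ (k:::sh)\ (\mathsf{build1}\ k\ (\lambda i.\ t))$ (B) Rules for $\mathsf{index}$: - $\mathsf{index}\ t\ [\,]\leadsto t$ - $\mathsf{index}\ (\mathsf{index}\ t\ [u_1,\ldots,u_m])\ [t_1,\ldots,t_n]\leadsto\mathsf{index}\ t\ [u_1,\ldots,u_m,t_1,\ldots,t_n]$ - $\mathsf{index}\ (\mathsf{let}\ x=v\ \mathsf{in}\ t)\ ix\leadsto\mathsf{let}\ x=v\ \mathsf{in}\ \mathsf{index}\ t\ ix$ - $\mathsf{index}\ (\mathsf{cond}\ b\ u\ v)\ [t_1,\ldots,t_n]\leadsto\mathsf{let}\ i_1=t_1\ \mathsf{in}\ldots\mathsf{let}\ i_n=t_n\ \mathsf{in}\ \mathsf{cond}\ b\ (\mathsf{index}\ u\ [i_1,\ldots,i_n])\ (\mathsf{index}\ v\ [i_1,\ldots,i_n])$ - $\mathsf{index}\ (op\ t\ u)\ [t_1,\ldots,t_n]\leadsto\mathsf{let}\ i_1=t_1\ \mathsf{in}\ldots\mathsf{let}\ i_n=t_n\ \mathsf{in}\ op\ (\mathsf{index}\ t\ [i_1,\ldots,i_n])\ (\mathsf{index}\ u\ [i_1,\ldots,i_n])$ - $\mathsf{index}\ (op\ t)\ ix\leadsto op\ (\mathsf{index}\ t\ ix)$ - $\mathsf{index}\ (\mathsf{sumOuter}\ t)\ ix\leadsto\mathsf{sumOuter}\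 (\mathsf{index}\ (\mathsf{tr}_{1,\ldots,n,0}\ t)\ ix)$, with $n$ the length of $ix$ - $\mathsf{index}\ [t_1,\ldots,t_k]\ [u_1,\ldots,u_n]\leadsto\mathsf{let}\ i_2=u_2\ \mathsf{in}\ldots\mathsf{let}\ i_n=u_n\ \mathsf{in}\ \mathsf{index}\ [\mathsf{index}\ t_1\ [i_2,\ldots,i_n],\ldots,\mathsf{index}\ t_k\ [i_2,\ldots,i_n]]\ [u_1]$ if $n>1$ - $\mathsf{index}\ (\mathsf{replicate}\ k\ t)\ [u_1,\ldots,u_n]\leadsto\mathsf{index}\ t\ [u_2,\ldots,u_n]$ if $n>0$ - $\mathsf{index}\ (\mathsf{tr}_{b_0,\ldots,b_k}\ t)\ ix\leadsto\mathsf{index}\ (\mathsf{gather}\ sh\ t\ (\lambda[i_{b_0},\ldots,i_{b_k}].\ [i_0,\ldots,i_k]))\ ix$, with $sh$ the shape of the transposed array - $\mathsf{index}\ (\mathsf{reshape}\ sh\ t)\ ix\leadsto\mathsf{index}\ (\mathsf{gather}\ sh\ t\ (\lambda is.\ \mathsf{fromLinearIdx}\ (\mathsf{shape}\ t)\ (\mathsf{toLinearIdx}\ sh\ is)))\ ix$. Here $\mathsf{shape}\ t$ is the static shape of $t$, and $\mathsf{toLinearIdx}$, $\mathsf{fromLinearIdx}$ are macros that expand to index arithmetic flattening a multidimensional index to a linear one and converting it back. - $\mathsf{index}\ (\mathsf{gather}\ (k:::sh)\ t\ (\lambda(i:::is).\ ix))\ (u:::ix')\leadsto\mathsf{index}\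 (\mathsf{gather}\ sh\ t\ (\lambda is.\ \mathsf{let}\ i=u\ \mathsf{in}\ ix))\ ix'$, where the $\mathsf{let}$ is placed around each component of $ix$ - $\mathsf{index}\ (\mathsf{gather}\ sh\ t\ (\lambda[\,].\ ix))\ ix'\leadsto\mathsf{index}\ (\mathsf{index}\ t\ ix)\ ix'$ (C) Rules for $\mathsf{build1}$ of $\mathsf{index}$ ($x$ a variable, $c$ a constant, $sh'$ the shape of the $\mathsf{index}$ subterm on the left-hand side): - $\mathsf{build1}\ k\ (\lambda i.\ \mathsf{index}\ x\ ix)\leadsto\mathsf{gather}\ (k:::sh')\ x\ (\lambda[i].\ ix)$ - $\mathsf{build1}\ k\ (\lambda i.\ \mathsf{index}\ c\ ix)\leadsto\mathsf{gather}\ (k:::sh')\ c\ (\lambda[i].\ ix)$ - $\mathsf{build1}\ k\ (\lambda i.\ \mathsf{index}\ [t_1,\ldots,t_p]\ [t])\leadsto\mathsf{gather}\ (k:::sh')\ (\mathsf{build1}\ k\ (\lambda i.\ [t_1,\ldots,t_p]))\ (\lambda[i].\ [i,t])$ - $\mathsf{build1}\ k\ (\lambda i.\ \mathsf{index}\ (\mathsf{scatter}\ sh\ t\ (\lambda is_2.\ ix_2))\ ix)\leadsto\mathsf{gather}\ (k:::sh')\ (\mathsf{build1}\ k\ (\lambda i.\ \mathsf{scatter}\ sh\ t\ (\lambda is_2.\ ix_2)))\ (\lambda[i].\ i:::ix)$ if $ix$ is nonempty A term is a normal form if no subterm of it is an instance of the left-hand side of any of these rules (with its side condition satisfied). *)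

(* Defs.v *)
From Stdlib Require Import Arith List Permutation ZArith Reals.
From Stdlib Require Vector.
Import ListNotations.

Set Implicit Arguments.

(** * Syntax *)

Inductive elt : Type := EReal | EInt | EBool.

Definition elt_val (rho : elt) : Type :=
  match rho with EReal => R | EInt => Z | EBool => bool end.

Definition numeric (rho : elt) : Prop := rho = EReal \/ rho = EInt.

Notation shape := (list nat).

Definition shape_size (sh : shape) : nat := fold_right Nat.mul 1 sh.

Fixpoint tensor (A : Type) (sh : shape) : Type :=
  match sh with
  | [] => A
  | k :: sh' => Vector.t (tensor A sh') k
  end.

(* The language is generic in its elementwise operators; the four named ones
   are what the linear-index macros expand to. *)
Record operators : Type := Operators {
  arith_op : Type;
  cmp_op : Type;
  unary_op : Type;
  op_add : arith_op;
  op_mul : arith_op;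
  op_quot : arith_op;
  op_rem : arith_op
}.

Inductive binary_op (O : operators) : Type :=
| Arith (o : arith_op O)
| Cmp (o : cmp_op O).

(* Variables are de Bruijn indices, so terms are identified up to renaming of
   bound variables.  [Let u v] and [Build1 k t] bind index 0 in [v] and [t].
   [Gather sh t m ix] is gather sh t (fun [i_1, .., i_m] => ix) and binds m
   variables in every component of [ix]: i_1 is the outermost binder, with
   index m-1, and i_m has index 0.  Likewise for [Scatter]. *)
Inductive term (O : operators) : Type :=
| Const (sh : shape) (rho : elt) (c : tensor (elt_val rho) sh)
| Var (x : nat)
| Let (u v : term O)
| Cond (b u v : term O)
| Op2 (o : binary_op O) (t u : term O)
| Op1 (o : unary_op O) (t : term O)
| Index (t : term O) (ix : list (term O))
| SumOuter (t : term O)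
| Gather (sh : shape) (t : term O) (m : nat) (ix : list (term O))
| Scatter (sh : shape) (t : term O) (m : nat) (ix : list (term O))
| Arr (ts : list (term O))
| Replicate (k : nat) (t : term O)
| Tr (js : list nat) (t : term O)
| Reshape (sh : shape) (t : term O)
| Build1 (k : nat) (t : term O).

Arguments Const {O} sh rho c.
Arguments Var {O} x.
Arguments Arr {O} ts.

(* [free_in x t]: the variable with index x belongs to FV(t). *)
Fixpoint free_in (O : operators) (x : nat) (t : term O) : bool :=
  match t with
  | Const _ _ _ => false
  | Var y => Nat.eqb x y
  | Let u v => free_in x u || free_in (S x) v
  | Cond b u v => free_in x b || free_in x u || free_in x v
  | Op2 _ t u => free_in x t || free_in x u
  | Op1 _ t => free_in x t
  | Index t ix => free_in x t || existsb (free_in x) ix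
  | SumOuter t => free_in x t
  | Gather _ t m ix => free_in x t || existsb (free_in (m + x)) ix
  | Scatter _ t m ix => free_in x t || existsb (free_in (m + x)) ix
  | Arr ts => existsb (free_in x) ts
  | Replicate _ t => free_in x t
  | Tr _ t => free_in x t
  | Reshape _ t => free_in x t
  | Build1 _ t => free_in (S x) t
  end.

Definition up_ren (m : nat) (r : nat -> nat) (x : nat) : nat :=
  if x <? m then x else m + r (x - m).

Fixpoint rename (O : operators) (r : nat -> nat) (t : term O) : term O :=
  match t with
  | Const sh rho c => Const sh rho c
  | Var x => Var (r x)
  | Let u v => Let (rename r u) (rename (up_ren 1 r) v)
  | Cond b u v => Cond (rename r b) (rename r u) (rename r v)
  | Op2 o t u => Op2 o (rename r t) (rename r u)
  | Op1 o t => Op1 o (rename r t)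
  | Index t ix => Index (rename r t) (map (rename r) ix)
  | SumOuter t => SumOuter (rename r t)
  | Gather sh t m ix =>
      Gather sh (rename r t) m (map (rename (up_ren m r)) ix)
  | Scatter sh t m ix =>
      Scatter sh (rename r t) m (map (rename (up_ren m r)) ix)
  | Arr ts => Arr (map (rename r) ts)
  | Replicate k t => Replicate k (rename r t)
  | Tr js t => Tr js (rename r t)
  | Reshape sh t => Reshape sh (rename r t)
  | Build1 k t => Build1 k (rename (up_ren 1 r) t)
  end.

Definition shift (O : operators) (n : nat) : term O -> term O :=
  rename (Nat.add n).

Definition up_subst (O : operators) (m : nat) (s : nat -> term O) (x : nat)
  : term O :=
  if x <? m then Var x else shift m (s (x - m)).

Fixpoint subst (O : operators) (s : nat -> term O) (t : term O) : term O :=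
  match t with
  | Const sh rho c => Const sh rho c
  | Var x => s x
  | Let u v => Let (subst s u) (subst (up_subst 1 s) v)
  | Cond b u v => Cond (subst s b) (subst s u) (subst s v)
  | Op2 o t u => Op2 o (subst s t) (subst s u)
  | Op1 o t => Op1 o (subst s t)
  | Index t ix => Index (subst s t) (map (subst s) ix)
  | SumOuter t => SumOuter (subst s t)
  | Gather sh t m ix =>
      Gather sh (subst s t) m (map (subst (up_subst m s)) ix)
  | Scatter sh t m ix =>
      Scatter sh (subst s t) m (map (subst (up_subst m s)) ix)
  | Arr ts => Arr (map (subst s) ts)
  | Replicate k t => Replicate k (subst s t)
  | Tr js t => Tr js (subst s t)
  | Reshape sh t => Reshape sh (subst s t)
  | Build1 k t => Build1 k (subst (up_subst 1 s) t)
  end.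

Definition children (O : operators) (t : term O) : list (term O) :=
  match t with
  | Const _ _ _ => []
  | Var _ => []
  | Let u v => [u; v]
  | Cond b u v => [b; u; v]
  | Op2 _ t u => [t; u]
  | Op1 _ t => [t]
  | Index t ix => t :: ix
  | SumOuter t => [t]
  | Gather _ t _ ix => t :: ix
  | Scatter _ t _ ix => t :: ix
  | Arr ts => ts
  | Replicate _ t => [t]
  | Tr _ t => [t]
  | Reshape _ t => [t]
  | Build1 _ t => [t]
  end.

Inductive subterm (O : operators) (s : term O) : term O -> Prop :=
| subterm_refl : subterm s s
| subterm_child t c : In c (children t) -> subterm s c -> subterm s t.

(** * Types *)

Inductive type : Type := Array (sh : shape) (rho : elt).

Definition ctx : Type := list type.

Definition int_scalar : type := Array [] EInt.

Definition binary_res (O : operators) (o : binary_op O) (rho : elt) : elt :=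
  match o with Arith _ _ => rho | Cmp _ _ => EBool end.

Inductive has_type (O : operators) (G : ctx) : term O -> type -> Prop :=
| T_Const sh rho (c : tensor (elt_val rho) sh) :
    has_type G (Const sh rho c) (Array sh rho)
| T_Var x tau :
    nth_error G x = Some tau ->
    has_type G (Var x) tau
| T_Let u v sigma tau :
    has_type G u sigma ->
    has_type (sigma :: G) v tau ->
    has_type G (Let u v) tau
| T_Cond b u v sh rho :
    has_type G b (Array [] EBool) ->
    has_type G u (Array sh rho) ->
    has_type G v (Array sh rho) ->
    has_type G (Cond b u v) (Array sh rho)
| T_Op2 o t u sh rho :
    has_type G t (Array sh rho) ->
    has_type G u (Array sh rho) ->
    has_type G (Op2 o t u) (Array sh (binary_res o rho))
| T_Op1 o t sh rho :
    has_type G t (Array sh rho) ->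
    has_type G (Op1 o t) (Array sh rho)
| T_Index t ix sh rho :
    has_type G t (Array sh rho) ->
    (forall u, In u ix -> has_type G u int_scalar) ->
    length ix <= length sh ->
    has_type G (Index t ix) (Array (skipn (length ix) sh) rho)
| T_SumOuter t k sh rho :
    numeric rho ->
    has_type G t (Array (k :: sh) rho) ->
    has_type G (SumOuter t) (Array sh rho)
| T_Gather sh' t m ix sh rho :
    has_type G t (Array sh rho) ->
    (forall u, In u ix -> has_type (repeat int_scalar m ++ G) u int_scalar) ->
    length sh' = m ->
    m <= length sh ->
    length ix <= length sh ->
    has_type G (Gather (sh' ++ skipn (length ix) sh) t m ix)
      (Array (sh' ++ skipn (length ix) sh) rho)
| T_Scatter sh' t m ix sh rho :
    numeric rho ->
    has_type G t (Array sh rho) ->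
    (forall u, In u ix -> has_type (repeat int_scalar m ++ G) u int_scalar) ->
    length sh' = length ix ->
    m <= length sh ->
    length ix <= length sh ->
    has_type G (Scatter (sh' ++ skipn m sh) t m ix)
      (Array (sh' ++ skipn m sh) rho)
| T_Arr ts sh rho :
    (forall t, In t ts -> has_type G t (Array sh rho)) ->
    has_type G (Arr ts) (Array (length ts :: sh) rho)
| T_Replicate k t sh rho :
    has_type G t (Array sh rho) ->
    has_type G (Replicate k t) (Array (k :: sh) rho)
| T_Tr js t sh rho :
    has_type G t (Array sh rho) ->
    length js <= length sh ->
    Permutation js (seq 0 (length js)) ->
    has_type G (Tr js t)
      (Array (map (fun j => nth j sh 0) js ++ skipn (length js) sh) rho)
| T_Reshape sh' t sh rho :
    has_type G t (Array sh rho) ->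
    shape_size sh = shape_size sh' ->
    has_type G (Reshape sh' t) (Array sh' rho)
| T_Build1 k t sh rho :
    has_type (int_scalar :: G) t (Array sh rho) ->
    has_type G (Build1 k t) (Array (k :: sh) rho).

(** * Rewriting *)

Definition int_const (O : operators) (n : nat) : term O :=
  Const [] EInt (Z.of_nat n).

Definition tr_swap (O : operators) (t : term O) : term O := Tr [1; 0] t.

(* The variables [i_1, .., i_n] under n consecutive binders. *)
Definition bound_vars (O : operators) (n : nat) : list (term O) :=
  map Var (rev (seq 0 n)).

(* [lets 0 [t_1, .., t_n] body] is let i_1 = t_1 in .. let i_n = t_n in body,
   where every t_j comes from the scope outside all of the lets, while [body]
   is already scoped under them. *)
Fixpoint lets (O : operators) (d : nat) (ts : list (term O)) (body : term O)
  : term O :=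
  match ts with
  | [] => body
  | t :: ts' => Let (shift d t) (lets (S d) ts' body)
  end.

(* u |-> u[index x [i] / x], from scope (G, i, x) to scope (G, x, i). *)
Definition let_build_subst (O : operators) (n : nat) : term O :=
  match n with
  | 0 => Index (Var 1) [Var 0]
  | 1 => Var 0
  | _ => Var n
  end.

(* From scope (G, i, is) to scope (G, is, i), where m is the length of is. *)
Definition move_inside (m x : nat) : nat :=
  if x <? m then S x else if x =? m then 0 else x.

Fixpoint position (j : nat) (js : list nat) : nat :=
  match js with
  | [] => 0
  | j' :: js' => if j =? j' then 0 else S (position j js')
  end.

(* The body of fun [i_(b_0), .., i_(b_k)] => [i_0, .., i_k]. *)
Definition permuted_vars (O : operators) (bs : list nat) : list (term O) :=
  map (fun j => Var (length bs - 1 - position j bs)) (seq 0 (length bs)).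

Fixpoint toLinearIdx (O : operators) (sh : shape) (ix : list (term O))
  : term O :=
  match sh, ix with
  | _ :: sh', i :: ix' =>
      Op2 (Arith O (op_add O))
        (Op2 (Arith O (op_mul O)) i (int_const O (shape_size sh')))
        (toLinearIdx sh' ix')
  | _, _ => int_const O 0
  end.

Fixpoint fromLinearIdx (O : operators) (sh : shape) (e : term O)
  : list (term O) :=
  match sh with
  | [] => []
  | _ :: sh' =>
      Op2 (Arith O (op_quot O)) e (int_const O (shape_size sh'))
      :: fromLinearIdx sh'
           (Op2 (Arith O (op_rem O)) e (int_const O (shape_size sh')))
  end.

(* [rule G l r]: l ~> r is an instance of a rewrite rule.  The context only
   serves to read off static shapes that occur on right-hand sides. *)
Inductive rule (O : operators) (G : ctx) : term O -> term O -> Prop :=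
| R_build_var k :
    rule G (Build1 k (Var 0)) (Arr (map (int_const O) (seq 0 k)))
| R_build_closed k t :
    free_in 0 t = false ->
    rule G (Build1 k t) (Replicate k (rename pred t))
| R_build_let k v u :
    rule G (Build1 k (Let v u))
      (Let (Build1 k v) (Build1 k (subst (let_build_subst O) u)))
| R_build_cond k b u v :
    rule G (Build1 k (Cond b u v))
      (Build1 k
         (Index (Arr [u; v]) [Cond b (int_const O 0) (int_const O 1)]))
| R_build_op2 k o t u :
    rule G (Build1 k (Op2 o t u)) (Op2 o (Build1 k t) (Build1 k u))
| R_build_op1 k o t :
    rule G (Build1 k (Op1 o t)) (Op1 o (Build1 k t))
| R_build_sumOuter k t :
    rule G (Build1 k (SumOuter t)) (SumOuter (tr_swap (Build1 k t)))
(* With i the first, hence outermost, of the bound variables i ::: is, [ix]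
   needs no renaming and i itself has index m. *)
| R_build_gather k sh t m ix :
    rule G (Build1 k (Gather sh t m ix))
      (Gather (k :: sh) (Build1 k t) (S m) (Var m :: ix))
| R_build_scatter k sh t m ix :
    rule G (Build1 k (Scatter sh t m ix))
      (Scatter (k :: sh) (Build1 k t) (S m) (Var m :: ix))
| R_build_arr k ts :
    rule G (Build1 k (Arr ts)) (tr_swap (Arr (map (@Build1 O k) ts)))
| R_build_replicate k n t :
    rule G (Build1 k (Replicate n t)) (tr_swap (Replicate n (Build1 k t)))
| R_build_tr k bs t :
    rule G (Build1 k (Tr bs t)) (Tr (0 :: map S bs) (Build1 k t))
| R_build_reshape k sh t :
    rule G (Build1 k (Reshape sh t)) (Reshape (k :: sh) (Build1 k t))

| R_index_nil t :
    rule G (Index t []) t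
| R_index_index t us ts :
    rule G (Index (Index t us) ts) (Index t (us ++ ts))
| R_index_let v t ix :
    rule G (Index (Let v t) ix) (Let v (Index t (map (@shift O 1) ix)))
| R_index_cond b u v ts :
    let n := length ts in
    rule G (Index (Cond b u v) ts)
      (lets 0 ts
         (Cond (shift n b)
            (Index (shift n u) (bound_vars O n))
            (Index (shift n v) (bound_vars O n))))
| R_index_op2 o t u ts :
    let n := length ts in
    rule G (Index (Op2 o t u) ts)
      (lets 0 ts
         (Op2 o
            (Index (shift n t) (bound_vars O n))
            (Index (shift n u) (bound_vars O n))))
| R_index_op1 o t ix :
    rule G (Index (Op1 o t) ix) (Op1 o (Index t ix))
| R_index_sumOuter t ix :
    rule G (Index (SumOuter t) ix)
      (SumOuter (Index (Tr (seq 1 (length ix) ++ [0]) t) ix))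
| R_index_arr ts u us :
    let n := length us in
    us <> [] ->
    rule G (Index (Arr ts) (u :: us))
      (lets 0 us
         (Index
            (Arr (map (fun t => Index (shift n t) (bound_vars O n)) ts))
            [shift n u]))
| R_index_replicate k t u us :
    rule G (Index (Replicate k t) (u :: us)) (Index t us)
| R_index_tr bs t ix sh rho :
    has_type G (Tr bs t) (Array sh rho) ->
    rule G (Index (Tr bs t) ix)
      (Index (Gather sh t (length bs) (permuted_vars O bs)) ix)
| R_index_reshape sh t ix sh' rho :
    has_type G t (Array sh' rho) ->
    rule G (Index (Reshape sh t) ix)
      (Index
         (Gather sh t (length sh)
            (fromLinearIdx sh' (toLinearIdx sh (bound_vars O (length sh)))))
         ix)
| R_index_gather_cons k sh t m ix u ix' :
    rule G (Index (Gather (k :: sh) t (S m) ix) (u :: ix'))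
      (Index
         (Gather sh t m
            (map (fun s => Let (shift m u) (rename (move_inside m) s)) ix))
         ix')
| R_index_gather_nil sh t ix ix' :
    rule G (Index (Gather sh t 0 ix) ix') (Index (Index t ix) ix')

(* [Var (S x)] is a variable other than the one bound by [Build1]; the
   right-hand side, where it is called [Var x], would not be in scope
   otherwise. *)
| R_build_index_var k x ix sh' rho :
    has_type (int_scalar :: G) (Index (Var (S x)) ix) (Array sh' rho) ->
    rule G (Build1 k (Index (Var (S x)) ix))
      (Gather (k :: sh') (Var x) 1 ix)
| R_build_index_const k sh rho (c : tensor (elt_val rho) sh) ix sh' rho' :
    has_type (int_scalar :: G) (Index (Const sh rho c) ix) (Array sh' rho') ->
    rule G (Build1 k (Index (Const sh rho c) ix))
      (Gather (k :: sh') (Const sh rho c) 1 ix)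
| R_build_index_arr k ts t sh' rho :
    has_type (int_scalar :: G) (Index (Arr ts) [t]) (Array sh' rho) ->
    rule G (Build1 k (Index (Arr ts) [t]))
      (Gather (k :: sh') (Build1 k (Arr ts)) 1 [Var 0; t])
| R_build_index_scatter k sh t m ix2 ix sh' rho :
    ix <> [] ->
    has_type (int_scalar :: G) (Index (Scatter sh t m ix2) ix)
      (Array sh' rho) ->
    rule G (Build1 k (Index (Scatter sh t m ix2) ix))
      (Gather (k :: sh') (Build1 k (Scatter sh t m ix2)) 1 (Var 0 :: ix)).

(* Application of a rule to an arbitrary subterm, including inside index lists
   and under binders. *)
Inductive step (O : operators) (G : ctx) : term O -> term O -> Prop :=
| S_rule t t' : rule G t t' -> step G t t'
| S_let_def u u' v : step G u u' -> step G (Let u v) (Let u' v)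
| S_let_body u v v' sigma :
    has_type G u sigma -> step (sigma :: G) v v' ->
    step G (Let u v) (Let u v')
| S_cond_b b b' u v : step G b b' -> step G (Cond b u v) (Cond b' u v)
| S_cond_l b u u' v : step G u u' -> step G (Cond b u v) (Cond b u' v)
| S_cond_r b u v v' : step G v v' -> step G (Cond b u v) (Cond b u v')
| S_op2_l o t t' u : step G t t' -> step G (Op2 o t u) (Op2 o t' u)
| S_op2_r o t u u' : step G u u' -> step G (Op2 o t u) (Op2 o t u')
| S_op1 o t t' : step G t t' -> step G (Op1 o t) (Op1 o t')
| S_index t t' ix : step G t t' -> step G (Index t ix) (Index t' ix)
| S_index_ix t l s s' r :
    step G s s' -> step G (Index t (l ++ s :: r)) (Index t (l ++ s' :: r))
| S_sumOuter t t' : step G t t' -> step G (SumOuter t) (SumOuter t')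
| S_gather sh t t' m ix :
    step G t t' -> step G (Gather sh t m ix) (Gather sh t' m ix)
| S_gather_ix sh t m l s s' r :
    step (repeat int_scalar m ++ G) s s' ->
    step G (Gather sh t m (l ++ s :: r)) (Gather sh t m (l ++ s' :: r))
| S_scatter sh t t' m ix :
    step G t t' -> step G (Scatter sh t m ix) (Scatter sh t' m ix)
| S_scatter_ix sh t m l s s' r :
    step (repeat int_scalar m ++ G) s s' ->
    step G (Scatter sh t m (l ++ s :: r)) (Scatter sh t m (l ++ s' :: r))
| S_arr l s s' r :
    step G s s' -> step G (Arr (l ++ s :: r)) (Arr (l ++ s' :: r))
| S_replicate k t t' : step G t t' -> step G (Replicate k t) (Replicate k t')
| S_tr js t t' : step G t t' -> step G (Tr js t) (Tr js t')
| S_reshape sh t t' : step G t t' -> step G (Reshape sh t) (Reshape sh t')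
| S_build k t t' :
    step (int_scalar :: G) t t' -> step G (Build1 k t) (Build1 k t').

Definition normal_form (O : operators) (G : ctx) (t : term O) : Prop :=
  ~ exists t', step G t t'.

Inductive permitted_index (O : operators) : term O -> list (term O) -> Prop :=
| P_var x v ix : permitted_index (Var x) (v :: ix)
| P_const sh rho (c : tensor (elt_val rho) sh) v ix :
    permitted_index (Const sh rho c) (v :: ix)
| P_arr ts v : permitted_index (Arr ts) [v]
| P_scatter sh t m ix2 v ix : permitted_index (Scatter sh t m ix2) (v :: ix).

(* Main.v *)
Require Import Defs.
From Stdlib Require Import List.
Import ListNotations.

Set Implicit Arguments.

(** Every left-hand side is a [Build1] or an [Index], and none of the [Index]
    ones is permitted, so a term with properties (1) and (2) has no redex.
    Conversely, an innermost violation of (1) or (2) in a well-typed term is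
    itself a redex.  Typing supplies the static shapes that occur in the rules
    and excludes the two stuck forms: [build1 k (fun i => index i (v ::: ix))],
    where the scalar [i] is indexed, and [index (gather [] t (fun is => _)) _]
    with nonempty [is]. *)

(** The part of (1) and (2) that concerns the head alone; imposed on all subterms, it gives both
    properties. *)
Definition admissible {O : operators} (t : term O) : Prop :=
  match t with
  | Build1 _ _ => False
  | Index u ix => permitted_index u ix
  | _ => True
  end.

Definition hereditarily_admissible {O : operators} (t : term O) : Prop :=
  forall s, subterm s t -> admissible s.

Lemma hereditarily_admissible_iff (O : operators) (t : term O) :
  hereditarily_admissible t <->
  (forall (k : nat) (s : term O), ~ subterm (Build1 k s) t) /\
  (forall (u : term O) (ix : list (term O)),
     subterm (Index u ix) t -> permitted_index u ix).
Proof.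
  split.
  - intros H; split.
    + intros k s Hs; exact (H _ Hs).
    + intros u ix Hs; exact (H _ Hs).
  - intros [HB HI] s Hs; destruct s; simpl; auto.
    exact (HB _ _ Hs).
Qed.

Lemma hereditarily_admissible_child (O : operators) (t c : term O) :
  hereditarily_admissible t -> In c (children t) -> hereditarily_admissible c.
Proof. intros H Hc s Hs; apply H; econstructor; eauto. Qed.

Lemma hereditarily_admissible_intro (O : operators) (t : term O) :
  admissible t ->
  (forall c, In c (children t) -> hereditarily_admissible c) ->
  hereditarily_admissible t.
Proof.
  intros Ht Hc s Hs; inversion Hs; subst; auto.
  eapply Hc; eauto.
Qed.

Lemma hereditarily_admissible_self (O : operators) (t : term O) :
  hereditarily_admissible t -> admissible t.
Proof. intros H; apply H; constructor. Qed.

Lemma rule_not_admissible (O : operators) (G : ctx) (t t' : term O) :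
  rule G t t' -> ~ admissible t.
Proof.
  (* Inversion leaves only [R_index_arr]: there [P_arr] forces [us = []], against the side
     condition. *)
  intros H; destruct H; simpl; try tauto; intros HP; inversion HP; subst;
    congruence.
Qed.

(** Induction follows the congruence rules down to the contracted redex, which is inadmissible. *)
Lemma step_not_hereditarily_admissible (O : operators) (G : ctx)
  (t t' : term O) :
  step G t t' -> ~ hereditarily_admissible t.
Proof.
  intros H; induction H as [G t t' H | | | | | | | | | | | | | | | | | | | | ];
    intros HA;
    try (apply IHstep; eapply hereditarily_admissible_child;
         [exact HA | simpl; rewrite ?in_app_iff; simpl; tauto]).
  exact (rule_not_admissible H (hereditarily_admissible_self HA)).
Qed.

(** The four permitted index forms of the body are those treated by the rules for [Build1] of
    [Index]; any other admissible head has a direct rule. *)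
Lemma build1_rule (O : operators) (G : ctx) (k : nat) (t : term O) sh rho :
  has_type (int_scalar :: G) t (Array sh rho) -> admissible t ->
  exists r, rule G (Build1 k t) r.
Proof.
  intros HT HA; destruct t as [ | x | | | | | u ix | | | | | | | | ];
    simpl in HA; try tauto;
    try solve [eexists; constructor; reflexivity | eexists; constructor].
  - destruct x as [ | x]; eexists; [apply R_build_var | ].
    apply R_build_closed; reflexivity.
  - destruct HA as [x v ix | | | ].
    + destruct x as [ | x]; [exfalso | eexists; eapply R_build_index_var, HT].
      (* [Var 0] has empty shape but the index is nonempty, so the length bound in [T_Index]
         fails. *)
      inversion HT as [ | | | | | | ? ? sh0 rho0 Hx _ Hle | | | | | | | | ]; subst.
      inversion Hx as [ | ? ? Hn | | | | | | | | | | | | | ]; subst.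
      injection Hn as <- <-; simpl in Hle; inversion Hle.
    + eexists; eapply R_build_index_const, HT.
    + eexists; eapply R_build_index_arr, HT.
    + eexists; eapply R_build_index_scatter, HT; discriminate.
Qed.

(** An empty index is always a redex; for a nonempty one the head of [u] decides, and admissibility
    rules out [Build1]. *)
Lemma index_permitted_or_rule (O : operators) (G : ctx) (u : term O) ix
  sh rho :
  has_type G u (Array sh rho) -> admissible u ->
  permitted_index u ix \/ exists r, rule G (Index u ix) r.
Proof.
  intros HT HA; destruct ix as [ | v ix]; [right; eexists; constructor | ].
  destruct u as [ | | | | | | | | sh0 t m ix0 | | ts | | | sh0 t | ];
    simpl in HA; try tauto;
    try solve [left; constructor | right; eexists; constructor].
  - right; destruct m as [ | m]; [eexists; apply R_index_gather_nil | ].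
    destruct sh0 as [ | k sh0]; [exfalso | eexists; apply R_index_gather_cons].
    (* Typing makes the gather shape begin with [sh'] of length [S m], so it is not empty. *)
    inversion HT as [ | | | | | | | | sh' ? ? ? ? ? ? ? Hlen | | | | | | ].
    destruct sh'; discriminate.
  - destruct ix as [ | w ix]; [left; constructor | right].
    eexists; apply R_index_arr; discriminate.
  - right; eexists; eapply R_index_tr, HT.
  (* Unlike [R_index_tr], this rule reads the shape of the argument, hence the inversion. *)
  - right; inversion HT; subst; eexists; eapply R_index_reshape; eassumption.
Qed.

Lemma normal_form_no_rule (O : operators) (G : ctx) (t : term O) :
  normal_form G t -> ~ exists r, rule G t r.
Proof. intros HN [r Hr]; apply HN; exists r; constructor; exact Hr. Qed.

(** [plug] is the one-hole context around [c]; [G'] may differ from [G] because the hole may lie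
    under binders. *)
Lemma normal_form_congr (O : operators) (G G' : ctx) (t c : term O)
  (plug : term O -> term O) :
  (forall c', step G' c c' -> step G t (plug c')) ->
  normal_form G t -> normal_form G' c.
Proof. intros H HN [c' Hc]; apply HN; exists (plug c'); auto. Qed.

Lemma normal_form_congr_list (O : operators) (G G' : ctx)
  (plug : list (term O) -> term O) (ts : list (term O)) :
  (forall l s s' r, step G' s s' ->
     step G (plug (l ++ s :: r)) (plug (l ++ s' :: r))) ->
  normal_form G (plug ts) -> forall c, In c ts -> normal_form G' c.
Proof.
  intros H HN c Hc; destruct (in_split _ _ Hc) as (l & r & ->).
  revert HN; eapply normal_form_congr with (plug := fun c' => plug (l ++ c' :: r)).
  intros; auto.
Qed.

(** Induction on typing yields hypotheses for each member of an index list and tracks the contexts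
    under binders that [step] refers to. *)
Lemma normal_form_hereditarily_admissible (O : operators) (G : ctx)
  (t : term O) tau :
  has_type G t tau -> normal_form G t -> hereditarily_admissible t.
Proof.
  induction 1 as
    [ G sh rho c
    | G x tau Hx
    | G u v sigma tau Hu IHu Hv IHv
    | G b u v sh rho Hb IHb Hu IHu Hv IHv
    | G o t u sh rho Ht IHt Hu IHu
    | G o t sh rho Ht IHt
    | G t ix sh rho Ht IHt Hix IHix Hlen
    | G t k sh rho Hrho Ht IHt
    | G sh' t m ix sh rho Ht IHt Hix IHix Hlen Hm Hlix
    | G sh' t m ix sh rho Hrho Ht IHt Hix IHix Hlen Hm Hlix
    | G ts sh rho Hts IHts
    | G k t sh rho Ht IHt
    | G js t sh rho Ht IHt Hlen Hperm
    | G sh' t sh rho Ht IHt Hsize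
    | G k t sh rho Ht IHt ];
    intros HN;
    (* The head has to be treated after the children: a rule applies to a
       [Build1] or a forbidden [Index] only once its argument is admissible. *)
    match goal with |- hereditarily_admissible ?t =>
      assert (HC : forall c, In c (children t) -> hereditarily_admissible c)
    end;
    try (apply hereditarily_admissible_intro; [ | exact HC]);
    try exact I; simpl in *.
  - tauto.
  - tauto.
  - intros c [<- | [<- | []]]; [apply IHu | apply IHv];
      revert HN; eapply normal_form_congr; intros c' Hc;
      [apply S_let_def | eapply S_let_body]; eassumption.
  - intros c [<- | [<- | [<- | []]]]; [apply IHb | apply IHu | apply IHv];
      revert HN; eapply normal_form_congr; intros c' Hc;
      [apply S_cond_b | apply S_cond_l | apply S_cond_r]; exact Hc.
  - intros c [<- | [<- | []]]; [apply IHt | apply IHu];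
      revert HN; eapply normal_form_congr; intros c' Hc;
      [apply S_op2_l | apply S_op2_r]; exact Hc.
  - intros c [<- | []]; apply IHt; revert HN; eapply normal_form_congr.
    intros c'; apply S_op1.
  - intros c [<- | Hc].
    + apply IHt; revert HN; eapply normal_form_congr.
      intros c'; apply S_index.
    + apply (IHix _ Hc); revert HN c Hc; apply normal_form_congr_list.
      intros; apply S_index_ix; assumption.
  - destruct (index_permitted_or_rule ix Ht) as [HP | HR]; [ | exact HP | ].
    + apply hereditarily_admissible_self, HC; auto.
    + destruct (normal_form_no_rule HN HR).
  - intros c [<- | []]; apply IHt; revert HN; eapply normal_form_congr.
    intros c'; apply S_sumOuter.
  - intros c [<- | Hc].
    + apply IHt; revert HN; eapply normal_form_congr.
      intros c'; apply S_gather.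
    + apply (IHix _ Hc); revert HN c Hc; apply normal_form_congr_list.
      intros; apply S_gather_ix; assumption.
  - intros c [<- | Hc].
    + apply IHt; revert HN; eapply normal_form_congr.
      intros c'; apply S_scatter.
    + apply (IHix _ Hc); revert HN c Hc; apply normal_form_congr_list.
      intros; apply S_scatter_ix; assumption.
  - intros c Hc; apply (IHts _ Hc); revert HN c Hc.
    apply normal_form_congr_list; intros; apply S_arr; assumption.
  - intros c [<- | []]; apply IHt; revert HN; eapply normal_form_congr.
    intros c'; apply S_replicate.
  - intros c [<- | []]; apply IHt; revert HN; eapply normal_form_congr.
    intros c'; apply S_tr.
  - intros c [<- | []]; apply IHt; revert HN; eapply normal_form_congr.
    intros c'; apply S_reshape.
  - intros c [<- | []]; apply IHt; revert HN; eapply normal_form_congr.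
    intros c'; apply S_build.
  (* Admissibility of a [Build1] is [False], so a redex at the head must contradict normality. *)
  - apply (normal_form_no_rule HN), (build1_rule k Ht).
    apply hereditarily_admissible_self, HC; auto.
Qed.

Theorem theorem5p1 :
  forall (O : operators) (G : ctx) (t : term O) (tau : type),
    has_type G t tau ->
    (normal_form G t <->
     (forall (k : nat) (s : term O), ~ subterm (Build1 k s) t) /\
     (forall (u : term O) (ix : list (term O)),
        subterm (Index u ix) t -> permitted_index u ix)).
Proof.
  intros O G t tau HT; rewrite <- hereditarily_admissible_iff; split.
  - exact (normal_form_hereditarily_admissible HT).
  - intros HA [t' Hs]; exact (step_not_hereditarily_admissible Hs HA).
Qed.
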